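(* There exist an absolute constant $C>0$ and a randomized online edge-coloring algorithm with the following guarantee. For all integers $n\ge 2$ and $\Delta\ge 1$, and for every adaptive adversary that reveals the edges of an $n$-vertex graph of maximum degree $\Delta$ one at a time, the algorithm (given $n$ and $\Delta$ in advance) always outputs a proper edge coloring, and with high probability in $n$ (i.e., with probability at least $1-1/n^{c}$ for some absolute constant $c>0$) it uses at most $$\Delta + C\,\Delta^{15/16}(\ln n)^{1/16}$$ distinct colors.
   Context: Online edge coloring: an unknown graph $G=(V,E)$ with $|V|=n$ and maximum degree $\Delta$ is given to the algorithm via $V$ and $\Delta$ in advance; edges are revealed one at a time, and upon arrival each edge must be immediately and irrevocably assigned a color so that edges sharing an endpoint receive distinct colors. An adaptive adversary chooses each next edge (subject to the final graph having maximum degree $\Delta$ on vertex set $V$) as a function of all previous random choices/outputs of the algorithm; the probability is over the algorithm's internal randomness. *)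

(* Defs.v *)
From HB Require Import structures.
From mathcomp Require Import all_boot all_order all_algebra.
From mathcomp Require Import reals.

Set Implicit Arguments.
Unset Strict Implicit.
Unset Printing Implicit Defensive.

Import Order.TTheory GRing.Theory Num.Theory.
Local Open Scope ring_scope.

Definition edge (n : nat) := {e : {set 'I_n} | #|e| == 2%N}.

Definition share_endpoint (n : nat) (e f : edge n) : bool :=
  val e :&: val f != set0.

Definition degree (n : nat) (E : seq (edge n)) (v : 'I_n) : nat :=
  count (fun e : edge n => v \in val e) E.

Definition max_degree (n : nat) (E : seq (edge n)) : nat :=
  \max_(v < n) degree E v.

(** One round of the game: the revealed edge, the random choice made by the
    algorithm in that round, and the color it output. *)
Definition round (n : nat) (coin : finType) : Type :=
  (edge n * coin * nat)%type.

Definition transcript (n : nat) (coin : finType) : Type :=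
  seq (round n coin).

(** In every round the algorithm makes a random choice in [coin], with a law that
    may depend on the past and on the arriving edge; the color of the edge is a
    function of the past, the edge and this choice. Edges of the past are never
    recolored, since colors are only recorded in the transcript. *)
Record online_algorithm (R : realType) (n : nat) := OnlineAlgorithm {
  coin : finType;
  law : transcript n coin -> edge n -> coin -> R;
  law_ge0 : forall t e r, 0 <= law t e r;
  law_sum1 : forall t e, \sum_(r : coin) law t e r = 1;
  color : transcript n coin -> edge n -> coin -> nat }.

(** The adversary sees all the past random choices and outputs; [None] means that
    all the edges have been revealed. *)
Definition adversary (R : realType) (n : nat) (A : online_algorithm R n) :=
  transcript n (coin A) -> option (edge n).

Definition edges (n : nat) (coin : finType) (t : transcript n coin) :
  seq (edge n) := [seq x.1.1 | x <- t].

Definition colors (n : nat) (coin : finType) (t : transcript n coin) :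
  seq nat := [seq x.2 | x <- t].

Definition extend (R : realType) (n : nat) (A : online_algorithm R n)
    (t : transcript n (coin A)) (e : edge n) (r : coin A) :
    transcript n (coin A) :=
  rcons t (e, r, color t e r).

(** The transcripts that occur with positive probability. *)
Inductive play (R : realType) (n : nat) (A : online_algorithm R n)
    (adv : adversary A) : transcript n (coin A) -> Prop :=
| play_nil : play adv [::]
| play_extend t e r : play adv t -> adv t = Some e -> 0 < law t e r ->
    play adv (extend t e r).

Definition complete_play (R : realType) (n : nat) (A : online_algorithm R n)
    (adv : adversary A) (t : transcript n (coin A)) : Prop :=
  play adv t /\ adv t = None.

(** Since no edge is revealed twice, a legal adversary stops after at most
    [#|edge n|] rounds. *)
Definition legal_adversary (R : realType) (n : nat) (A : online_algorithm R n)
    (Delta : nat) (adv : adversary A) : Prop :=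
  (forall t, play adv t -> uniq (edges t)) /\
  (forall t, complete_play adv t -> max_degree (edges t) = Delta).

Definition proper_coloring (n : nat) (coin : finType)
    (t : transcript n coin) : Prop :=
  forall x y : round n coin, x \in t -> y \in t ->
    x.1.1 != y.1.1 -> share_endpoint x.1.1 y.1.1 -> x.2 != y.2.

Definition num_colors (n : nat) (coin : finType) (t : transcript n coin) : nat :=
  size (undup (colors t)).

(** The probability that the transcript satisfies [E] when the game is continued
    from [t] for at most [k] further rounds. *)
Fixpoint prob_from (R : realType) (n : nat) (A : online_algorithm R n)
    (adv : adversary A) (E : pred (transcript n (coin A)))
    (k : nat) (t : transcript n (coin A)) : R :=
  if k is k'.+1 then
    if adv t is Some e then
      \sum_(r : coin A) law t e r * prob_from adv E k' (extend t e r)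
    else (E t)%:R
  else (E t)%:R.

(** For a legal adversary the game is over after [#|edge n|] rounds, so this is
    the probability that the final transcript satisfies [E]. *)
Definition prob (R : realType) (n : nat) (A : online_algorithm R n)
    (adv : adversary A) (E : pred (transcript n (coin A))) : R :=
  prob_from adv E #|{: edge n}| [::].

(* Main.v *)
Require Import Defs.
From mathcomp Require Import all_boot all_order all_algebra.
From mathcomp Require Import reals sequences exp.
From mathcomp Require Import ring lra.

Set Implicit Arguments.
Unset Strict Implicit.
Unset Printing Implicit Defensive.

Import Order.TTheory GRing.Theory Num.Theory.
Local Open Scope ring_scope.

(** Every vertex [v] and main color [c] carry a weight [w v c], initially [1].
    A random algorithm would give color [c] to the arriving edge [uv] with
    probability [p c = r * w u c * w v c], where [r = (1 - eps) / Delta]; the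
    weights of [c] at [u] and [v] then become [0] if [c] is chosen and are
    divided by [1 - p c] otherwise, so each weight is a martingale. While it is
    positive, [1 / w v c = 1 - r * \sum_u w u c], the sum being over the past
    neighbors [u] of [v] with [w u c] taken at the arrival of [uv]. For fixed
    sets [U] of vertices and [K] of colors these weights sum over [U] and [K] to
    a martingale, and a union bound over all the pairs [(U, K)] copes with the
    adaptive choice of the neighbors: at each vertex, all but
    [eps ^ 3 * Delta / 32] colors keep a weight at most [2 / eps], so that
    discarding the heavy colors costs little. As [\sum_c w u c * w v c] also
    stays close to [Delta], every edge receives a main color with probability
    at least [1 - 4 eps], and at most [7 eps Delta] edges at each vertex are
    left; they are colored greedily with [14 eps Delta + 1] spare colors.

    The exponential moments used in the concentration bounds add up to a
    potential whose conditional expectation never increases. Always choosing an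
    outcome of least potential therefore gives a deterministic algorithm that
    satisfies all the bounds against every adversary. With
    [eps = 4 (ln n / Delta) ^ (1 / 16)] all the union bounds are affordable. *)

Lemma expR_le_inv1B (R : realType) (x : R) : x < 1 -> expR x <= (1 - x)^-1.
Proof.
move=> x_lt1; rewrite -[leLHS]invrK -expRN.
by rewrite lef_pV2 ?posrE ?expR_gt0 ?subr_gt0 // expR_ge1Dx.
Qed.

Lemma expR_le_quadratic (R : realType) (x : R) :
  x <= 1 / 2 -> expR x <= 1 + x + 2 * x ^+ 2.
Proof.
move=> x_le; have B1x_gt0 : 0 < 1 - x by lra.
apply: le_trans (expR_le_inv1B _) _; first by lra.
rewrite -div1r ler_pdivrMr //.
have : 0 <= x ^+ 2 * (1 - 2 * x) by rewrite mulr_ge0 ?sqr_ge0 //; lra.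
lra.
Qed.

Lemma expR_half_le2 (R : realType) : expR (1 / 2) <= 2 :> R.
Proof.
apply: le_trans (expR_le_inv1B _) _; first by lra.
by rewrite -div1r ler_pdivrMr; lra.
Qed.

Lemma expR1_le4 (R : realType) : expR 1 <= 4 :> R.
Proof.
rewrite [X in expR X](_ : 1 = 2%:R * (1 / 2)); last by field.
rewrite [leRHS](_ : 4 = 2 ^+ 2); last by ring.
by rewrite expRM_natl lerXn2r ?nnegrE ?expR_ge0 // expR_half_le2.
Qed.

Lemma sum_exprn_card (R : comNzRingType) (T : finType) (x : R) :
  \sum_(U : {set T}) x ^+ #|U| = (x + 1) ^+ #|T|.
Proof.
rewrite -cardsT -prodr_const.
under eq_bigl do rewrite inE.
rewrite bigA_distr /=; apply: eq_big => [U|U _]; first by rewrite inE.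
by rewrite -big_mkcond /= prodr_const.
Qed.

Lemma ler_sum_term (R : numDomainType) (I : finType) (P : pred I) (F : I -> R)
    (i : I) :
  P i -> (forall j, P j -> 0 <= F j) -> F i <= \sum_(j | P j) F j.
Proof.
move=> Pi F_ge0; rewrite (bigD1 i) //= lerDl sumr_ge0 // => j /andP[Pj _].
exact: F_ge0.
Qed.

(** * Means over the outcomes of a round *)

Section Mean.
Variables (R : realDomainType) (I : finType) (p : I -> R).
Implicit Types x y : option I -> R.

Definition mean x : R :=
  (1 - \sum_i p i) * x None + \sum_i p i * x (Some i).

Definition possible (o : option I) : bool :=
  if o is Some i then p i != 0 else true.

Lemma eq_mean x y : x =1 y -> mean x = mean y.
Proof.
move=> xy; rewrite /mean xy; congr (_ + _).
by apply: eq_bigr => i _; rewrite xy.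
Qed.

Lemma meanZ k x : mean (fun o => k * x o) = k * mean x.
Proof.
rewrite /mean mulrDr mulrCA; congr (_ + _).
by rewrite mulr_sumr; apply: eq_bigr => i _; rewrite mulrCA.
Qed.

Lemma meanD x y : mean (fun o => x o + y o) = mean x + mean y.
Proof.
rewrite /mean mulrDr addrACA -big_split /=; congr (_ + _).
by apply: eq_bigr => i _; rewrite mulrDr.
Qed.

Lemma mean_sum (J : finType) (P : pred J) (x : J -> option I -> R) :
  mean (fun o => \sum_(j | P j) x j o) = \sum_(j | P j) mean (x j).
Proof.
rewrite /mean big_split /= mulr_sumr; congr (_ + _).
by rewrite exchange_big /=; apply: eq_bigr => i _; rewrite mulr_sumr.
Qed.

Lemma mean_cst k : mean (fun=> k) = k.
Proof. by rewrite /mean -mulr_suml -mulrDl subrK mul1r. Qed.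

Hypothesis p_ge0 : forall i, 0 <= p i.
Hypothesis sum_p_le1 : \sum_i p i <= 1.

Lemma ler_mean x y : (forall o, possible o -> x o <= y o) -> mean x <= mean y.
Proof.
move=> xy; apply: lerD; first by rewrite ler_wpM2l ?subr_ge0 ?xy.
apply: ler_sum => i _; have [->|pi_neq0] := eqVneq (p i) 0.
  by rewrite !mul0r.
by rewrite ler_wpM2l ?xy.
Qed.

Lemma arg_min_le_mean x :
  x [arg min_(o < None | possible o) x o]%O <= mean x.
Proof.
case: arg_minP => //= o _ o_min.
by rewrite -[leLHS]mean_cst; apply: ler_mean.
Qed.

End Mean.

Section Change.
Variables (R : realFieldType) (I : finType) (p : I -> R).
Implicit Types (i : I) (o : option I).

(** A quantity that must vanish when the outcome is [i], and is otherwise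
    multiplied by the constant that makes it a martingale, changes by this
    proportion. *)
Definition change i o : R := if o == Some i then -1 else p i / (1 - p i).

Lemma changeE i o : p i != 1 ->
  change i o = (1 - p i)^-1 * (p i - (o == Some i)%:R).
Proof.
move=> p_neq1; have B1p_neq0 : 1 - p i != 0 by rewrite subr_eq0 eq_sym.
by rewrite /change; case: (o == Some i); rewrite ?mulr1n ?mulr0n; field.
Qed.

Lemma mean_change i : p i != 1 -> mean p (change i) = 0.
Proof.
move=> p_neq1; rewrite (eq_mean _ (fun o => changeE o p_neq1)).
rewrite meanZ meanD mean_cst /mean mulr0n oppr0 mulr0 add0r.
rewrite (bigD1 i) //= eqxx big1 => [|j ji].
  by rewrite addr0 mulrN1 subrr mulr0.
by rewrite (inj_eq Some_inj) (negbTE ji) oppr0 mulr0.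
Qed.

Hypothesis p_ge0 : forall i, 0 <= p i.
Hypothesis p_le_half : forall i, p i <= 1 / 2.
Hypothesis sum_p_le1 : \sum_i p i <= 1.

Lemma sum_norm_change o : \sum_i `|change i o| <= 3.
Proof.
have change_le i : `|change i o| <= 2 * p i + (o == Some i)%:R.
  rewrite /change; have := p_ge0 i; have := p_le_half i.
  case: (o == Some i) => p_le p_ge; first by rewrite normrN1 lerDr mulr_ge0.
  rewrite addr0 ger0_norm; last by apply: divr_ge0 => //; lra.
  by rewrite ler_pdivrMr; [nra|lra].
apply: le_trans (ler_sum _ (fun i _ => change_le i)) _.
rewrite big_split /= -mulr_sumr.
have : \sum_i (o == Some i)%:R <= 1 :> R.
  case: o {change_le} => [j|]; last by rewrite big1.
  rewrite (bigD1 j) //= eqxx big1 ?addr0 // => i ij.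
  by rewrite (inj_eq Some_inj) eq_sym (negbTE ij).
by have := sum_p_le1; lra.
Qed.

End Change.

Section ExponentialMean.
Variables (R : realType) (I : finType) (p : I -> R).
Hypothesis p_ge0 : forall i, 0 <= p i.
Hypothesis sum_p_le1 : \sum_i p i <= 1.
Implicit Types x Y : option I -> R.

Lemma mean_expR_le x theta y k :
  (forall o, `|x o| <= theta) -> theta <= 1 / 2 -> mean p x <= 0 ->
  2 * theta ^+ 2 <= k -> mean p (fun o => expR (y + x o - k)) <= expR y.
Proof.
move=> x_le theta_le mean_x k_ge.
rewrite (@eq_mean _ _ _ _ (fun o => expR (y - k) * expR (x o))); last first.
  by move=> o; rewrite -expRD addrAC.
rewrite meanZ -[X in _ <= expR X](subrK k) [leRHS]expRD ler_wpM2l ?expR_ge0 //.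
apply: (@le_trans _ _ (mean p (fun o => (1 + k) + x o))).
  apply: ler_mean => // o _.
  have := x_le o; rewrite ler_norml => /andP[Ntheta_le le_theta].
  apply: le_trans (expR_le_quadratic _) _; first exact: le_trans theta_le.
  have : x o ^+ 2 <= theta ^+ 2 by nra.
  lra.
by rewrite meanD mean_cst (le_trans _ (expR_ge1Dx _)) // gerDl.
Qed.

Hypothesis p_le_half : forall i, p i <= 1 / 2.

(* [j] counts the vertices whose degree increases: if there are none, then [g]
   vanishes and nothing needs to be compensated. *)
Lemma mean_expR_change (g : I -> R) gamma Y y (j : nat) :
  0 <= gamma -> 6 * gamma <= 1 -> (forall i, `|g i| <= gamma * (0 < j)%N%:R) ->
  (forall o, Y o = y + \sum_i g i * change p i o - 18 * gamma ^+ 2 * j%:R) ->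
  mean p (fun o => expR (Y o)) <= expR y.
Proof.
move=> gamma_ge0 gamma_le g_le YE.
rewrite (eq_mean _ (fun o => congr1 expR (YE o))).
have b_le : (0 < j)%N%:R <= 1 :> R by rewrite lern1 leq_b1.
have gb_ge0 : 0 <= gamma * (0 < j)%N%:R by rewrite mulr_ge0.
apply: (@mean_expR_le _ (3 * (gamma * (0 < j)%N%:R))).
- move=> o; apply: le_trans (ler_norm_sum _ _ _) _.
  apply: (@le_trans _ _ (\sum_i gamma * (0 < j)%N%:R * `|change p i o|)).
    by apply: ler_sum => i _; rewrite normrM ler_wpM2r.
  by rewrite -mulr_sumr mulrC ler_wpM2r // sum_norm_change.
- by have := ler_wpM2l gamma_ge0 b_le; lra.
- rewrite mean_sum big1 // => i _.
  by rewrite meanZ mean_change ?mulr0 //; have := p_le_half i; lra.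
- have -> : 2 * (3 * (gamma * (0 < j)%N%:R)) ^+ 2 =
      18 * gamma ^+ 2 * (0 < j)%N%:R ^+ 2 by ring.
  rewrite ler_wpM2l ?mulr_ge0 ?sqr_ge0 //.
  by rewrite -natrX ler_nat; case: j {g_le YE b_le gb_ge0}.
Qed.

End ExponentialMean.

(** * Edges and neighbors *)

Section Edges.
Variable n : nat.
Implicit Types (e f : edge n) (E : seq (edge n)) (u v w : 'I_n).

Lemma share_endpointP e f :
  reflect (exists2 v, v \in val e & v \in val f) (share_endpoint e f).
Proof.
rewrite /share_endpoint; apply: (iffP (set0Pn _)) => [[v]|[v ve vf]].
  by rewrite inE => /andP[]; exists v.
by exists v; rewrite inE ve.
Qed.

Lemma share_endpointC e f : share_endpoint e f = share_endpoint f e.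
Proof. by rewrite /share_endpoint setIC. Qed.

Lemma edge_other_endpoint e v : v \in val e -> exists u, val e = [set v; u].
Proof.
have /cards2P[x [y [_ ->]]] := valP e; rewrite !inE => /orP[] /eqP ->.
  by exists y.
by exists x; rewrite setUC.
Qed.

Lemma edge_pair_neq e u v : val e = [set u; v] -> u != v.
Proof.
by move=> eE; have := valP e; rewrite eE /= cards2; case: (u != v).
Qed.

Lemma edge_eq_pair e u v :
  u != v -> u \in val e -> v \in val e -> val e = [set u; v].
Proof.
move=> uv ue ve; apply/esym/eqP.
by rewrite eqEcard (eqP (valP e)) cards2 uv subUset !sub1set ue ve.
Qed.

Lemma set2_injr v : injective (fun u : 'I_n => [set v; u]).
Proof.
move=> u w uw.
have /set2P[uv|//] : u \in [set v; w] by rewrite -uw set22.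
have /set2P[wv|//] : w \in [set v; u] by rewrite uw set22.
by rewrite uv wv.
Qed.

Definition linked E v u : bool := [set v; u] \in map val E.

Definition neighbors E v : {set 'I_n} := [set u | linked E v u].

Lemma linkedC E u v : linked E u v = linked E v u.
Proof. by rewrite /linked setUC. Qed.

Lemma linked_cons e E v u :
  linked (e :: E) v u = (val e == [set v; u]) || linked E v u.
Proof. by rewrite /linked inE eq_sym. Qed.

Lemma linked_consW e E v u : linked E v u -> linked (e :: E) v u.
Proof. by rewrite linked_cons => ->; rewrite orbT. Qed.

Lemma linked_edge e E v u : val e = [set v; u] -> linked E v u = (e \in E).
Proof. by move=> eE; rewrite /linked -eE mem_map //; apply: val_inj. Qed.

Lemma neighbors_nil v : neighbors [::] v = set0.
Proof. by apply/setP => u; rewrite !inE. Qed.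

Lemma neighbors_cons_notin e E v :
  v \notin val e -> neighbors (e :: E) v = neighbors E v.
Proof.
move=> ve; apply/setP => u; rewrite !inE linked_cons.
by case: eqP => // eE; rewrite eE setU11 in ve.
Qed.

Lemma neighbors_cons_pair e E v u :
  val e = [set v; u] -> neighbors (e :: E) v = u |: neighbors E v.
Proof.
move=> eE; apply/setP => w; rewrite !inE linked_cons eE eq_sym.
by rewrite (inj_eq (@set2_injr v)).
Qed.

Lemma degree_cons e E v : degree (e :: E) v = ((v \in val e) + degree E v)%N.
Proof. by []. Qed.

Lemma sum_degree_cons e E (U : {set 'I_n}) :
  (\sum_(u in U) degree (e :: E) u =
   #|U :&: val e| + \sum_(u in U) degree E u)%N.
Proof.
rewrite -sum1_card big_mkcond [X in _ = (X + _)%N]big_mkcond /=.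
rewrite [X in _ = (_ + X)%N]big_mkcond -big_split; apply: eq_bigr => u _ /=.
by rewrite inE; case: (u \in U); case: (u \in val e).
Qed.

Lemma card_neighbors E v : (#|neighbors E v| <= degree E v)%N.
Proof.
rewrite /degree -size_filter -(size_map val).
rewrite cardE -(size_map (fun u => [set v; u])).
apply: uniq_leq_size.
  by rewrite map_inj_uniq ?enum_uniq //; apply: set2_injr.
move=> _ /mapP[u + ->]; rewrite mem_enum inE => /mapP[e eE ve].
by rewrite ve map_f // mem_filter -ve setU11.
Qed.

End Edges.

(** * Weights *)

(** The most recent round comes first; [None] is the outcome of a round whose
    edge does not receive a main color. *)
Definition history (n : nat) (C : finType) := seq (edge n * option C).

Section Weights.
Variables (R : realFieldType) (n : nat) (C : finType) (rate cap : R).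
Implicit Types (h : history n C) (e f : edge n) (o : option C).
Implicit Types (u v w : 'I_n) (c : C).

(* A color whose weight at [v] exceeds [cap] is never used at [v] again. *)
Definition capped (x : R) : R := if x <= cap then x else 0.

(** [weight h v c] is the inverse of the conditional probability that [c] is
    still free at [v], and [0] once [c] is used at [v]. *)
Fixpoint weight h v c : R :=
  if h is (e, o) :: h' then
    if v \in val e then
      if o == Some c then 0
      else
        weight h' v c / (1 - rate * \prod_(w in val e) capped (weight h' w c))
    else weight h' v c
  else 1.

Definition color_prob h e c : R :=
  rate * \prod_(w in val e) capped (weight h w c).

(** The weight of [c] at [u], stopped when the edge [vu] arrives. *)
Fixpoint stopped h v u c : R :=
  if h is _ :: h' then
    if linked (unzip1 h) v u then stopped h' v u c else weight h u c
  else 1.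

Definition load h v c : R := \sum_(u in neighbors (unzip1 h) v) stopped h v u c.

Definition heavy h v : {set C} := [set c | cap < weight h v c].

Lemma weight_cons h e o v c :
  weight ((e, o) :: h) v c =
  if v \in val e then
    if o == Some c then 0 else weight h v c / (1 - color_prob h e c)
  else weight h v c.
Proof. by []. Qed.

Lemma capped_id x : 0 <= x -> capped x <= x.
Proof. by rewrite /capped; case: ifP. Qed.

Lemma capped_ge0 x : 0 <= x -> 0 <= capped x.
Proof. by rewrite /capped; case: ifP. Qed.

Lemma capped_gt x : cap < x -> capped x = 0.
Proof. by rewrite /capped leNgt => ->. Qed.

Lemma color_prob_pair h e u v c : val e = [set u; v] ->
  color_prob h e c = rate * (capped (weight h u c) * capped (weight h v c)).
Proof.
move=> eE; rewrite /color_prob eE big_setU1 ?big_set1 //.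
by rewrite inE (edge_pair_neq eE).
Qed.

Lemma color_prob_eq0 h e v c :
  v \in val e -> capped (weight h v c) = 0 -> color_prob h e c = 0.
Proof.
by move=> ve capped0; rewrite /color_prob (bigD1 v) //= capped0 mul0r mulr0.
Qed.

Lemma weight_used h f v c :
  (f, Some c) \in h -> v \in val f -> weight h v c = 0.
Proof.
elim: h => [|[e o] h IH] //; rewrite inE => /orP[/eqP[<- <-]|fh] vf.
  by rewrite weight_cons vf eqxx.
by rewrite weight_cons IH // mul0r !if_same.
Qed.

Lemma color_prob_used h e f c :
  (f, Some c) \in h -> share_endpoint f e -> color_prob h e c = 0.
Proof.
move=> fh /share_endpointP[v vf ve]; apply: (color_prob_eq0 ve).
by rewrite (weight_used fh vf) /capped if_same.
Qed.

Lemma stopped_unlinked h v u c :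
  ~~ linked (unzip1 h) v u -> stopped h v u c = weight h u c.
Proof. by case: h => [|x h] //= /negbTE ->. Qed.

Lemma stopped_cons_linked h e o v u c :
  linked (e :: unzip1 h) v u -> stopped ((e, o) :: h) v u c = stopped h v u c.
Proof. by move=> /= ->. Qed.

Lemma load_nil v c : load [::] v c = 0.
Proof. by rewrite /load neighbors_nil big_set0. Qed.

Lemma load_cons_notin h e o v c :
  v \notin val e -> load ((e, o) :: h) v c = load h v c.
Proof.
move=> ve; rewrite /load neighbors_cons_notin //; apply: eq_bigr => u.
by rewrite inE => uv; rewrite stopped_cons_linked // linked_consW.
Qed.

Lemma load_cons_pair h e o v u c : val e = [set v; u] -> e \notin unzip1 h ->
  load ((e, o) :: h) v c = weight h u c + load h v c.
Proof.
move=> eE e_new.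
have unlinked : ~~ linked (unzip1 h) v u by rewrite (linked_edge _ eE).
rewrite /load (neighbors_cons_pair _ eE) big_setU1 ?inE //.
congr (_ + _).
  by rewrite stopped_cons_linked ?stopped_unlinked // linked_cons eE eqxx.
apply: eq_bigr => w; rewrite inE => wv.
by rewrite stopped_cons_linked // linked_consW.
Qed.

Hypothesis rate_ge0 : 0 <= rate.
Hypothesis cap_ge1 : 1 <= cap.
Hypothesis rate_cap : 2 * rate * cap ^+ 2 <= 1.

Lemma capped_le x : capped x <= cap.
Proof.
by rewrite /capped; case: ifP => // _; exact: le_trans ler01 cap_ge1.
Qed.

Lemma color_prob_range h e c :
  (forall v, 0 <= weight h v c) -> 0 <= color_prob h e c <= 1 / 2.
Proof.
move=> w_ge0; rewrite mulr_ge0 ?prodr_ge0 //= => [|v _]; last exact: capped_ge0.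
apply: (@le_trans _ _ (rate * cap ^+ 2)); last by move: rate_cap; lra.
rewrite ler_wpM2l // -[X in cap ^+ X](eqP (valP e)) -prodr_const.
by apply: ler_prod => v _; rewrite capped_ge0 ?capped_le.
Qed.

Lemma weight_range h v c : 0 <= weight h v c <= 2 * cap.
Proof.
elim: h v => [|[e o] h IH] v.
  by apply/andP; split; move: cap_ge1 => /=; lra.
rewrite weight_cons; case: ifP => // ve; have /andP[w_ge0 w_le] := IH v.
have /andP[p_ge0 p_le] := color_prob_range e (fun u => proj1 (andP (IH u))).
case: eqP => _; first by rewrite lexx; move: cap_ge1; lra.
rewrite divr_ge0 ?subr_ge0 //=; last by lra.
rewrite ler_pdivrMr; last by lra.
have [w_cap|cap_w] := leP (weight h v c) cap; first by nra.
by rewrite (color_prob_eq0 ve (capped_gt cap_w)) subr0 mulr1.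
Qed.

Lemma weight_ge0 h v c : 0 <= weight h v c.
Proof. by have /andP[] := weight_range h v c. Qed.

Lemma weight_le h v c : weight h v c <= 2 * cap.
Proof. by have /andP[] := weight_range h v c. Qed.

Lemma color_prob_ge0 h e c : 0 <= color_prob h e c.
Proof. by have /andP[] := color_prob_range e (weight_ge0 h ^~ c). Qed.

Lemma color_prob_le_half h e c : color_prob h e c <= 1 / 2.
Proof. by have /andP[] := color_prob_range e (weight_ge0 h ^~ c). Qed.

Lemma weight_step h e o u c :
  weight ((e, o) :: h) u c = weight h u c +
    (u \in val e)%:R * (weight h u c * change (color_prob h e) c o).
Proof.
rewrite weight_cons; case: (u \in val e); last by rewrite mul0r addr0.
rewrite mul1r /change; case: (o == Some c); first by rewrite mulrN1 subrr.
have p_neq1 : 1 - color_prob h e c != 0.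
  by have := color_prob_le_half h e c; lra.
by field.
Qed.

Lemma sum_color_prob_pair h e u v : val e = [set u; v] ->
  \sum_c color_prob h e c =
  rate * \sum_c capped (weight h u c) * capped (weight h v c).
Proof.
by move=> eE; rewrite mulr_sumr; apply: eq_bigr => c _; apply: color_prob_pair.
Qed.

Lemma sum_capped_le h u v :
  \sum_c capped (weight h u c) * capped (weight h v c) <=
  \sum_c weight h u c * weight h v c.
Proof.
by apply: ler_sum => c _; rewrite ler_pM ?capped_ge0 ?capped_id ?weight_ge0.
Qed.

Lemma sum_capped_ge h u v :
  \sum_c weight h u c * weight h v c -
    4 * cap ^+ 2 * (#|heavy h u| + #|heavy h v|)%:R <=
  \sum_c capped (weight h u c) * capped (weight h v c).
Proof.
rewrite -!sum1_card !(big_mkcond (fun c => c \in _)) -big_split /= natr_sum.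
rewrite mulr_sumr -sumrB; apply: ler_sum => c _; rewrite !inE /capped.
have w_mul_le : weight h u c * weight h v c <= 2 * cap * (2 * cap).
  by rewrite ler_pM ?weight_ge0 ?weight_le.
have w_mul_ge0 := mulr_ge0 (weight_ge0 h u c) (weight_ge0 h v c).
have cap2_ge0 := sqr_ge0 cap.
by case: leP => _; case: leP => _; rewrite ?mulr0n ?mulr1n /=; lra.
Qed.

(** The arrival of [e] changes the weight of [u], not yet stopped by [vu]. *)
Definition moves h e v u : bool :=
  (u \in val e) && ~~ linked (e :: unzip1 h) v u.

Lemma stopped_step h e o v u c :
  stopped ((e, o) :: h) v u c = stopped h v u c +
    (moves h e v u)%:R * (weight h u c * change (color_prob h e) c o).
Proof.
rewrite /moves; have [uv_linked|unlinked] := boolP (linked (e :: unzip1 h) v u).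
  by rewrite stopped_cons_linked // andbF mul0r addr0.
rewrite stopped_unlinked // weight_step // andbT stopped_unlinked //.
by apply: contra unlinked; apply: linked_consW.
Qed.

(* The bound would be an equality for a color that is free at [v] and whose
   weights were never capped off. *)
Lemma weight_load_le1 h v c :
  uniq (unzip1 h) -> weight h v c * (1 - rate * load h v c) <= 1.
Proof.
elim: h => [_|[e o] h IH /andP[e_new /IH{}IH]].
  by rewrite load_nil mulr0 subr0 mulr1.
have [ve|ve] := boolP (v \in val e); last first.
  by rewrite load_cons_notin // weight_cons (negbTE ve).
have [u eE] := edge_other_endpoint ve.
rewrite (load_cons_pair _ _ eE) // weight_cons ve.
case: eqP => _; first by rewrite mul0r ler01.
have p_le : color_prob h e c <= rate * (weight h v c * weight h u c).
  rewrite (color_prob_pair _ _ eE) ler_wpM2l //.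
  by rewrite ler_pM ?capped_ge0 ?capped_id ?weight_ge0.
have p_le_half := color_prob_le_half h e c.
rewrite mulrAC ler_pdivrMr; lra.
Qed.

End Weights.

Arguments weight : simpl never.
Arguments stopped : simpl never.

(** * The potential *)

Section Potential.
Variables (R : realType) (n : nat) (C : finType) (rate cap lam eps : R).
Implicit Types (h : history n C) (e : edge n) (o : option C) (s : bool).
Implicit Types (u v : 'I_n) (c : C) (U : {set 'I_n}) (K : {set C}).

Local Notation weight := (weight rate cap).
Local Notation stopped := (stopped rate cap).
Local Notation color_prob := (color_prob rate cap).

Definition overflow h v : nat :=
  count (fun x : edge n * option C => (v \in val x.1) && (x.2 == None)) h.

Definition pair_deviation h u v : R :=
  \sum_c (stopped h v u c * stopped h u v c - 1).

Definition star_deviation h v U K : R :=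
  \sum_(c in K) \sum_(u in U) (stopped h v u c - 1).

Lemma pair_deviation_unlinked h u v : ~~ linked (unzip1 h) u v ->
  pair_deviation h u v = \sum_c weight h u c * weight h v c - #|C|%:R.
Proof.
move=> unlinked; rewrite /pair_deviation sumrB sumr_const; congr (_ - _).
by apply: eq_bigr => c _; rewrite !stopped_unlinked // linkedC.
Qed.

Lemma star_deviation_neighbors h v K :
  star_deviation h v (neighbors (unzip1 h) v) K =
  \sum_(c in K) (load rate cap h v c - #|neighbors (unzip1 h) v|%:R).
Proof. by apply: eq_bigr => c _; rewrite sumrB sumr_const. Qed.

Definition increment_bound : R := 4 * lam * cap ^+ 2.

(** Outweighs the second-order term of [expR] in a round that changes the
    exponent by at most [3 * increment_bound]. *)
Definition compensator : R := 18 * increment_bound ^+ 2.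

Definition pair_exponent h s u v : R :=
  (-1) ^+ s * lam * pair_deviation h u v -
  compensator * (degree (unzip1 h) u + degree (unzip1 h) v)%:R.

Definition star_exponent h v U K : R :=
  lam * star_deviation h v U K -
  compensator * (\sum_(u in U) degree (unzip1 h) u)%:R.

Definition overflow_exponent h v : R :=
  eps * ((overflow h v)%:R - 4 * eps * (degree (unzip1 h) v)%:R) -
  2 * eps ^+ 2 * (degree (unzip1 h) v)%:R.

(** Pays for the union bound over all the sets [U] and [K]. *)
Definition star_cost U : R := #|U|%:R * ln n%:R + #|C|%:R.

Definition pair_potential h : R :=
  \sum_(q : bool * 'I_n * 'I_n | q.1.2 != q.2)
    expR (pair_exponent h q.1.1 q.1.2 q.2).

Definition star_potential h : R :=
  \sum_v \sum_U \sum_K expR (star_exponent h v U K - star_cost U).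

Definition overflow_potential h : R := \sum_v expR (overflow_exponent h v).

Definition potential h : R :=
  pair_potential h + star_potential h + overflow_potential h.

Section InitialPotential.
Hypothesis n_ge2 : (2 <= n)%N.

Let nR_ge2 : 2 <= n%:R :> R. Proof. by rewrite ler_nat. Qed.
Let nR_gt0 : 0 < n%:R :> R. Proof. by rewrite ltr0n ltnW. Qed.

Lemma pair_potential_nil : pair_potential [::] <= 2 * n%:R ^+ 2.
Proof.
rewrite /pair_potential (eq_bigr (fun=> 1)) => [|q _]; last first.
  by rewrite /pair_exponent /pair_deviation big1 ?mulr0 ?subr0 ?expR0 // => c _;
     rewrite mulr1 subrr.
rewrite sumr_const -natrX -natrM ler_nat (leq_trans (max_card _)) //.
by rewrite !card_prod card_bool card_ord -mulnA mulnn.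
Qed.

Lemma sum_inv_exprn_card_le :
  \sum_(U : {set 'I_n}) n%:R^-1 ^+ #|U| <= 4 :> R.
Proof.
rewrite sum_exprn_card card_ord; apply: le_trans (expR1_le4 R).
rewrite [X in expR X](_ : 1 = n%:R * n%:R^-1); last by rewrite divff ?gt_eqF.
rewrite expRM_natl lerXn2r ?nnegrE ?expR_ge0 ?addr_ge0 ?invr_ge0 //.
by rewrite addrC expR_ge1Dx.
Qed.

Lemma star_potential_nil : star_potential [::] <= 4 * n%:R.
Proof.
have exponent0 v U K : star_exponent [::] v U K = 0.
  rewrite /star_exponent /star_deviation !big1 ?mulr0 ?subrr // => c _.
  by rewrite big1 // => u _; rewrite subrr.
rewrite /star_potential.
under eq_bigr do under eq_bigr do under eq_bigr do rewrite exponent0 add0r.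
rewrite sumr_const card_ord -[leLHS]mulr_natr ler_wpM2r //.
apply: le_trans sum_inv_exprn_card_le; apply: ler_sum => U _.
rewrite sumr_const -cardsT -powersetT card_powerset cardsT.
rewrite -[leLHS]mulr_natl natrX opprD expRD mulrCA.
rewrite -mulrN expRM_natl expRN lnK ?posrE //.
rewrite ler_piMr ?exprn_ge0 ?invr_ge0 //.
rewrite expRN ler_pdivrMr ?expR_gt0 // mul1r -[X in expR X]mulr1 expRM_natl.
by rewrite lerXn2r ?nnegrE ?expR_ge0 // (le_trans _ (expR_ge1Dx 1)).
Qed.

Lemma overflow_potential_nil : overflow_potential [::] = n%:R.
Proof.
rewrite /overflow_potential (eq_bigr (fun=> 1)) => [|v _].
  by rewrite sumr_const card_ord.
by rewrite /overflow_exponent /= !(mulr0n, mulr0, subr0) expR0.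
Qed.

Lemma potential_nil : potential [::] <= expR (5%:R * ln n%:R).
Proof.
rewrite expRM_natl lnK ?posrE //.
rewrite /potential overflow_potential_nil.
have := pair_potential_nil; have := star_potential_nil; move: nR_ge2.
move: (n%:R : R) => x x_ge2 star_le pair_le.
have x2_ge : 2 * x <= x ^+ 2 by nra.
have x3_ge : 8 <= x ^+ 3 by rewrite exprS; nra.
rewrite (_ : x ^+ 5 = x ^+ 2 * x ^+ 3); last by rewrite -exprD.
by move: x2_ge x3_ge pair_le star_le; move: (x ^+ 2) (x ^+ 3) => y z; nra.
Qed.

End InitialPotential.

Lemma pair_potential_ge0 h : 0 <= pair_potential h.
Proof. by apply: sumr_ge0 => q _; apply: expR_ge0. Qed.

Lemma star_potential_ge0 h : 0 <= star_potential h.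
Proof. by do 3!(apply: sumr_ge0 => ? _); apply: expR_ge0. Qed.

Lemma overflow_potential_ge0 h : 0 <= overflow_potential h.
Proof. by apply: sumr_ge0 => v _; apply: expR_ge0. Qed.

Section SmallPotential.
Variables (h : history n C) (b : R).
Hypothesis potential_le : potential h <= expR b.

Lemma pair_exponent_le s u v : u != v -> pair_exponent h s u v <= b.
Proof.
move=> uv; rewrite -ler_expR; apply: le_trans potential_le.
rewrite /potential -addrA ler_wpDr ?addr_ge0 ?star_potential_ge0 //.
  exact: overflow_potential_ge0.
apply: (ler_sum_term (F := fun q => expR (pair_exponent h q.1.1 q.1.2 q.2))
    (P := fun q => q.1.2 != q.2) (i := (s, u, v))) => // q _.
exact: expR_ge0.
Qed.

Lemma star_exponent_le v U K : star_exponent h v U K - star_cost U <= b.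
Proof.
rewrite -ler_expR; apply: le_trans potential_le.
rewrite /potential ler_wpDr ?overflow_potential_ge0 //.
rewrite ler_wpDl ?pair_potential_ge0 //.
pose F w V M := expR (star_exponent h w V M - star_cost V).
have F_ge0 w V M : 0 <= F w V M by apply: expR_ge0.
have F_sum_ge0 w V : 0 <= \sum_M F w V M by apply: sumr_ge0.
apply: le_trans (ler_sum_term (F := fun w => \sum_V \sum_M F w V M)
  (i := v) isT _); last by move=> w _; apply: sumr_ge0.
apply: le_trans (ler_sum_term (F := fun V => \sum_M F v V M)
  (i := U) isT _) => //.
exact: (ler_sum_term (F := F v U) (i := K) isT).
Qed.

Lemma overflow_exponent_le v : overflow_exponent h v <= b.
Proof.
rewrite -ler_expR; apply: le_trans potential_le.
rewrite ler_wpDl ?addr_ge0 ?pair_potential_ge0 ?star_potential_ge0 //.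
apply: (ler_sum_term (F := fun w => expR (overflow_exponent h w))) => // w _.
exact: expR_ge0.
Qed.

End SmallPotential.

Section Step.
Hypothesis rate_ge0 : 0 <= rate.
Hypothesis cap_ge1 : 1 <= cap.
Hypothesis rate_cap : 2 * rate * cap ^+ 2 <= 1.
Hypothesis lam_ge0 : 0 <= lam.
Hypothesis lam_cap : 24 * lam * cap ^+ 2 <= 1.

Variables (h : history n C) (e : edge n).
Hypothesis sum_color_prob_le1 : \sum_c color_prob h e c <= 1.

Let prob_ge0 c : 0 <= color_prob h e c :=
  color_prob_ge0 rate_ge0 cap_ge1 rate_cap h e c.
Let prob_le_half c : color_prob h e c <= 1 / 2 :=
  color_prob_le_half rate_ge0 cap_ge1 rate_cap h e c.
Let w_ge0 u c : 0 <= weight h u c :=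
  weight_ge0 rate_ge0 cap_ge1 rate_cap h u c.
Let w_le u c : weight h u c <= 2 * cap :=
  weight_le rate_ge0 cap_ge1 rate_cap h u c.

Let increment_bound_ge0 : 0 <= increment_bound.
Proof. by apply: mulr_ge0; [rewrite mulr_ge0|rewrite sqr_ge0]. Qed.

Let increment_bound_le : 6 * increment_bound <= 1.
Proof. by rewrite /increment_bound; move: lam_cap; lra. Qed.

Definition pair_gradient u v c : R :=
  (moves h e v u || moves h e u v)%:R * (weight h u c * weight h v c).

Lemma pair_deviation_step u v o : u != v ->
  pair_deviation ((e, o) :: h) u v =
  pair_deviation h u v +
  \sum_c pair_gradient u v c * change (color_prob h e) c o.
Proof.
move=> uv; rewrite -big_split; apply: eq_bigr => c _ /=.
rewrite !stopped_step // /pair_gradient /moves [linked _ u v]linkedC.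
have [_|unlinked] := boolP (linked (e :: unzip1 h) v u).
  by rewrite !andbF /=; ring.
have unlinked_before : ~~ linked (unzip1 h) v u.
  by apply: contra unlinked; apply: linked_consW.
rewrite !stopped_unlinked // 1?linkedC // !andbT.
have : ~~ ((u \in val e) && (v \in val e)).
  apply: contra unlinked => /andP[ue ve].
  by rewrite linked_cons setUC (edge_eq_pair uv ue ve) eqxx.
by case: (u \in val e); case: (v \in val e) => //= _; ring.
Qed.

Lemma norm_pair_gradient_le u v c : `|pair_gradient u v c| <=
  4 * cap ^+ 2 * (0 < (u \in val e) + (v \in val e))%N%:R.
Proof.
rewrite ger0_norm ?mulr_ge0 // [leLHS]mulrC ler_pM ?mulr_ge0 //.
  by rewrite [leRHS](_ : _ = 2 * cap * (2 * cap)) ?ler_pM //; ring.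
rewrite /moves ler_nat; case: (u \in val e); case: (v \in val e) => //;
  by case: (_ || _).
Qed.

Lemma mean_pair_exponent s u v : u != v ->
  mean (color_prob h e) (fun o => expR (pair_exponent ((e, o) :: h) s u v))
  <= expR (pair_exponent h s u v).
Proof.
move=> uv; apply: (mean_expR_change prob_ge0 sum_color_prob_le1 prob_le_half
    (g := fun c => (-1) ^+ s * lam * pair_gradient u v c)
    (j := (u \in val e) + (v \in val e))
    increment_bound_ge0 increment_bound_le).
  move=> c; rewrite 2!normrM normr_sign mul1r ger0_norm //.
  by apply: le_trans (ler_wpM2l lam_ge0 (norm_pair_gradient_le u v c)) _;
     rewrite /increment_bound; lra.
move=> o; rewrite /pair_exponent pair_deviation_step //.
rewrite !(degree_cons e (unzip1 h)) addnACA natrD.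
under [X in _ = _ + X - _]eq_bigr => c _ do
  rewrite /= -(mulrA _ (pair_gradient u v c)).
by rewrite -mulr_sumr /compensator; ring.
Qed.

Definition star_gradient v U K c : R :=
  (c \in K)%:R * \sum_(u in U) (moves h e v u)%:R * weight h u c.

Lemma star_deviation_step v U K o :
  star_deviation ((e, o) :: h) v U K = star_deviation h v U K +
  \sum_c star_gradient v U K c * change (color_prob h e) c o.
Proof.
have -> : \sum_c star_gradient v U K c * change (color_prob h e) c o =
    \sum_(c in K) \sum_(u in U)
      (moves h e v u)%:R * (weight h u c * change (color_prob h e) c o).
  rewrite [RHS]big_mkcond; apply: eq_bigr => c _; rewrite /star_gradient.
  case: (c \in K); rewrite ?mul0r // mul1r mulr_suml.
  by apply: eq_bigr => u _; rewrite mulrA.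
rewrite -big_split; apply: eq_bigr => c _ /=; rewrite -big_split.
by apply: eq_bigr => u _; rewrite stopped_step // addrAC.
Qed.

Lemma norm_star_gradient_le v U K c :
  `|star_gradient v U K c| <= 4 * cap ^+ 2 * (0 < #|U :&: val e|)%N%:R.
Proof.
have sum_ge0 : 0 <= \sum_(u in U) (moves h e v u)%:R * weight h u c.
  by apply: sumr_ge0 => u _; rewrite mulr_ge0.
rewrite ger0_norm ?mulr_ge0 //.
apply: (@le_trans _ _ (\sum_(u in U :&: val e) 2 * cap)).
  apply: (@le_trans _ _ (\sum_(u in U) (moves h e v u)%:R * weight h u c)).
    by rewrite ler_piMl // lern1 leq_b1.
  rewrite [leRHS](eq_bigl (fun u => (u \in U) && (u \in val e))) => [|u].
    rewrite big_mkcondr; apply: ler_sum => u _; rewrite /moves.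
    case: (u \in val e) => /=; last by rewrite mul0r.
    by case: (~~ _); rewrite ?mul1r ?mul0r // (le_trans (w_ge0 u c)).
  by rewrite inE.
rewrite sumr_const -[leLHS]mulr_natl.
have card_le : (#|U :&: val e| <= 2 * (0 < #|U :&: val e|))%N.
  have := subset_leq_card (subsetIr U (val e)); rewrite (eqP (valP e)).
  by case: #|_| => // j; rewrite muln1.
apply: (@le_trans _ _ ((2 * (0 < #|U :&: val e|)%N%:R) * (2 * cap))).
  by rewrite ler_wpM2r -?natrM ?ler_nat //; move: cap_ge1; lra.
have cap_le_sqr : cap <= cap ^+ 2 by move: cap_ge1; nra.
by have := ler_wpM2r (ler0n R (0 < #|U :&: val e|)) cap_le_sqr; lra.
Qed.

Lemma mean_star_exponent v U K :
  mean (color_prob h e) (fun o => expR (star_exponent ((e, o) :: h) v U K))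
  <= expR (star_exponent h v U K).
Proof.
apply: (mean_expR_change prob_ge0 sum_color_prob_le1 prob_le_half
    (g := fun c => lam * star_gradient v U K c) (j := #|U :&: val e|)
    increment_bound_ge0 increment_bound_le).
  move=> c; rewrite normrM ger0_norm //.
  by apply: le_trans (ler_wpM2l lam_ge0 (norm_star_gradient_le v U K c)) _;
     rewrite /increment_bound; lra.
move=> o; rewrite /star_exponent star_deviation_step.
rewrite (sum_degree_cons e (unzip1 h)).
under [X in _ = _ + X - _]eq_bigr => c _ do
  rewrite /= -(mulrA _ (star_gradient v U K c)).
by rewrite -mulr_sumr natrD /compensator; ring.
Qed.

Hypothesis eps_ge0 : 0 <= eps.
Hypothesis eps_le : eps <= 1 / 4.
Hypothesis sum_color_prob_ge : 1 - 4 * eps <= \sum_c color_prob h e c.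

Lemma mean_overflow_exponent v :
  mean (color_prob h e) (fun o => expR (overflow_exponent ((e, o) :: h) v))
  <= expR (overflow_exponent h v).
Proof.
pose b : R := (v \in val e)%:R.
pose x (o : option C) := b * eps * ((o == None)%:R - 4 * eps).
have exponent_step o : overflow_exponent ((e, o) :: h) v =
    overflow_exponent h v + x o - 2 * eps ^+ 2 * b.
  rewrite /overflow_exponent degree_cons /= natrD -/(overflow h v).
  by rewrite /x /b; case: (v \in val e); case: (o == None);
     rewrite /= ?mulr1n ?mulr0n ?add1n ?add0n ?mulrSr; ring.
rewrite (eq_mean _ (fun o => congr1 expR (exponent_step o))).
have b_ge0 : 0 <= b by [].
have b_le1 : b <= 1 by rewrite lern1 leq_b1.
apply: (@mean_expR_le _ _ _ prob_ge0 sum_color_prob_le1 _ (b * eps)).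
- move=> o; rewrite normrM [`|b * eps|]ger0_norm ?mulr_ge0 //.
  rewrite ler_piMr ?mulr_ge0 // ler_norml.
  by case: (o == None); rewrite ?mulr1n ?mulr0n; apply/andP; split;
     move: eps_ge0 eps_le; lra.
- by have := ler_wpM2r eps_ge0 b_le1; move: eps_le; lra.
- rewrite meanZ mulr_ge0_le0 ?mulr_ge0 // meanD mean_cst.
  rewrite /mean [X in _ + X - _]big1 => [|c _]; last by rewrite mulr0.
  by rewrite mulr1 addr0; move: sum_color_prob_ge; lra.
- rewrite /b; case: (v \in val e); rewrite ?mulr1n ?mulr0n; last by nra.
  by rewrite mul1r mulr1.
Qed.

Lemma mean_potential :
  mean (color_prob h e) (fun o => potential ((e, o) :: h)) <= potential h.
Proof.
rewrite !meanD; apply: lerD; first apply: lerD.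
- by rewrite mean_sum; apply: ler_sum => q; apply: mean_pair_exponent.
- rewrite mean_sum; apply: ler_sum => v _; rewrite mean_sum.
  apply: ler_sum => U _; rewrite mean_sum; apply: ler_sum => K _.
  rewrite (@eq_mean _ _ _ _ (fun o => expR (- star_cost U) *
    expR (star_exponent ((e, o) :: h) v U K))); last first.
    by move=> o; rewrite expRD mulrC.
  by rewrite meanZ expRD mulrC ler_wpM2r ?expR_ge0 ?mean_star_exponent.
- by rewrite mean_sum; apply: ler_sum => v _; apply: mean_overflow_exponent.
Qed.

End Step.
End Potential.

(** * Consequences of a small potential *)

Lemma ln_natr_ge_half (R : realType) n : (2 <= n)%N -> 1 / 2 <= ln n%:R :> R.
Proof.
move=> n_ge2; rewrite -[leLHS]expRK ler_ln ?posrE ?expR_gt0 ?ltr0n 1?ltnW //.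
by apply: le_trans (expR_half_le2 R) _; rewrite ler_nat.
Qed.

Definition rate (R : realType) (D : nat) (eps : R) : R := (1 - eps) / D%:R.

Definition cap (R : realType) (eps : R) : R := 2 / eps.

Record admissible (R : realType) (n D : nat) (lam eps : R) : Prop := {
  eps_gt0 : 0 < eps;
  eps_le_quarter : eps <= 1 / 4;
  lam_gt0 : 0 < lam;
  rate_budget : 2 * rate D eps * cap eps ^+ 2 <= 1;
  step_budget : 24 * lam * cap eps ^+ 2 <= 1;
  pair_budget :
    5 * ln n%:R + 2 * compensator (cap eps) lam * D%:R < lam * eps * D%:R;
  star_budget :
    8 * ln n%:R * D%:R + compensator (cap eps) lam * D%:R ^+ 2 <
    lam * (eps ^+ 3 / 32 * D%:R) * (D%:R * (eps / 2));
  overflow_budget : 5 * ln n%:R <= eps ^+ 2 * D%:R }.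

Definition best_outcome (R : realType) (n D : nat) (lam eps : R)
    (h : history n 'I_D) (e : edge n) : option 'I_D :=
  [arg min_(o < None | possible (color_prob (rate D eps) (cap eps) h e) o)
     potential (rate D eps) (cap eps) lam eps ((e, o) :: h)]%O.

Section SmallPotentialConsequences.
Variables (R : realType) (n D : nat) (lam eps : R).
Hypothesis n_ge2 : (2 <= n)%N.
Hypothesis D_gt0 : (0 < D)%N.
Hypothesis params_ok : admissible n D lam eps.

Variable h : history n 'I_D.
Hypothesis h_uniq : uniq (unzip1 h).
Hypothesis h_degree : forall v, (degree (unzip1 h) v <= D)%N.
Hypothesis h_potential :
  potential (rate D eps) (cap eps) lam eps h <= expR (5%:R * ln n%:R).

Implicit Types (u v : 'I_n) (c : 'I_D) (e : edge n).

Local Notation weight := (weight (rate D eps) (cap eps) h).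
Local Notation load := (load (rate D eps) (cap eps) h).
Local Notation heavy := (heavy (rate D eps) (cap eps) h).
Local Notation color_prob := (color_prob (rate D eps) (cap eps) h).
Local Notation star_deviation := (star_deviation (rate D eps) (cap eps) h).
Local Notation compensator := (compensator (cap eps) lam).

Let eps_pos : 0 < eps := eps_gt0 params_ok.
Let eps_small : eps <= 1 / 4 := eps_le_quarter params_ok.
Let lam_pos : 0 < lam := lam_gt0 params_ok.
Let DR_gt0 : 0 < D%:R :> R. Proof. by rewrite ltr0n. Qed.
Let ln_ge : 1 / 2 <= ln n%:R :> R := ln_natr_ge_half R n_ge2.

Lemma rate_gt0 : 0 < rate D eps.
Proof. by rewrite divr_gt0 // subr_gt0; move: eps_small; lra. Qed.

Lemma cap_ge1 : 1 <= cap eps.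
Proof. by rewrite ler_pdivlMr //; move: eps_small; lra. Qed.

Lemma compensator_ge0 : 0 <= compensator.
Proof. by apply: mulr_ge0 => //; apply: sqr_ge0. Qed.

Let rateD : rate D eps * D%:R = 1 - eps.
Proof. by rewrite divfK ?gt_eqF. Qed.

Let w_ge0 u c : 0 <= weight u c :=
  weight_ge0 (ltW rate_gt0) cap_ge1 (rate_budget params_ok) h u c.

Lemma sum_weight_mul_dist u v : u != v -> ~~ linked (unzip1 h) u v ->
  `|\sum_c weight u c * weight v c - D%:R| <= eps * D%:R.
Proof.
move=> uv unlinked; set dev := _ - _.
have dev_lt (s : bool) : lam * ((-1) ^+ s * dev) < lam * (eps * D%:R).
  have := pair_exponent_le h_potential s uv.
  rewrite /pair_exponent pair_deviation_unlinked // card_ord -/dev.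
  have : compensator * (degree (unzip1 h) u + degree (unzip1 h) v)%:R <=
      compensator * (2 * D%:R).
    rewrite ler_wpM2l ?compensator_ge0 // -natrM ler_nat mul2n -addnn.
    by rewrite leq_add.
  by have := pair_budget params_ok; lra.
have := dev_lt true; have := dev_lt false; rewrite expr0 expr1 !ltr_pM2l //.
by move=> dev_le dev_ge; rewrite ler_norml; apply/andP; split; lra.
Qed.

Lemma star_deviation_le v (U : {set 'I_n}) (K : {set 'I_D}) : (#|U| <= D)%N ->
  lam * star_deviation v U K <=
  8 * ln n%:R * D%:R + compensator * D%:R ^+ 2.
Proof.
move=> U_le; have := star_exponent_le h_potential v U K.
rewrite /star_exponent /star_cost card_ord.
have degree_le : compensator * (\sum_(u in U) degree (unzip1 h) u)%:R <=
    compensator * D%:R ^+ 2.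
  rewrite ler_wpM2l ?compensator_ge0 // -natrX ler_nat.
  apply: (@leq_trans (\sum_(u in U) D)); first exact: leq_sum.
  by rewrite sum_nat_const leq_mul.
have ln_ge0 : 0 <= ln n%:R :> R by move: ln_ge; lra.
have Uln_le : #|U|%:R * ln n%:R <= D%:R * ln n%:R :> R.
  by rewrite ler_wpM2r ?ler_nat.
have ln_le : ln n%:R <= D%:R * ln n%:R :> R by rewrite ler_peMl // ler1n.
have D_le : D%:R <= D%:R * (2 * ln n%:R) :> R.
  by rewrite ler_peMr //; move: ln_ge; lra.
lra.
Qed.

Lemma load_heavy_ge v c : c \in heavy v -> D%:R * (1 + eps / 2) <= load v c.
Proof.
rewrite inE => cap_lt.
have :=
  weight_load_le1 (ltW rate_gt0) cap_ge1 (rate_budget params_ok) v c h_uniq.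
set l := load v c => weight_load.
have rate_load : 1 - eps / 2 <= rate D eps * l.
  rewrite leNgt; apply/negP => rate_load_lt; move: weight_load; apply/negP.
  have cap_eps : cap eps * (eps / 2) = 1 by rewrite /cap; field; rewrite gt_eqF.
  rewrite -ltNge -[ltLHS]cap_eps ltr_pM //; first by move: cap_ge1; lra.
    by rewrite ltW // divr_gt0.
  by move: rate_load_lt; lra.
have eps_lt1 : 0 < 1 - eps by move: eps_small; lra.
rewrite -(ler_pM2l eps_lt1).
apply: (@le_trans _ _ ((1 - eps / 2) * D%:R)).
  by have := mulr_ge0 (ltW DR_gt0) (sqr_ge0 eps); lra.
by rewrite -ler_pdivlMr // mulrAC.
Qed.

Lemma star_deviation_heavy v :
  #|heavy v|%:R * (D%:R * (eps / 2)) <=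
  star_deviation v (neighbors (unzip1 h) v) (heavy v).
Proof.
rewrite star_deviation_neighbors mulr_natl -sumr_const.
apply: ler_sum => c /load_heavy_ge load_ge.
have : #|neighbors (unzip1 h) v|%:R <= D%:R :> R.
  by rewrite ler_nat (leq_trans (card_neighbors _ _)).
lra.
Qed.

Lemma card_heavy v : #|heavy v|%:R <= eps ^+ 3 / 32 * D%:R.
Proof.
have Deps_gt0 : 0 < D%:R * (eps / 2) by rewrite mulr_gt0 ?divr_gt0.
rewrite -(ler_pM2r Deps_gt0) -(ler_pM2l lam_pos).
apply: le_trans (ler_wpM2l (ltW lam_pos) (star_deviation_heavy v)) _.
apply: le_trans (star_deviation_le _ _ _) _.
  exact: leq_trans (card_neighbors _ _) (h_degree v).
by rewrite ltW // mulrA; apply: star_budget params_ok.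
Qed.

Lemma heavy_loss_le u v :
  4 * cap eps ^+ 2 * (#|heavy u| + #|heavy v|)%:R <= eps * D%:R.
Proof.
apply: (@le_trans _ _ (4 * cap eps ^+ 2 * (eps ^+ 3 / 16 * D%:R))).
  have -> : eps ^+ 3 / 16 * D%:R = eps ^+ 3 / 32 * D%:R + eps ^+ 3 / 32 * D%:R.
    by field.
  by rewrite ler_wpM2l 1?mulr_ge0 ?sqr_ge0 // natrD lerD ?card_heavy.
by rewrite le_eqVlt /cap; apply/orP; left; apply/eqP; field; rewrite gt_eqF.
Qed.

Lemma sum_color_prob_range e : e \notin unzip1 h ->
  1 - 4 * eps <= \sum_c color_prob e c <= 1.
Proof.
have /cards2P[u [v [uv eE]]] := valP e; rewrite -(linked_edge _ eE) => unlinked.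
rewrite (sum_color_prob_pair _ _ _ eE).
have := sum_weight_mul_dist uv unlinked.
rewrite ler_norml => /andP[sum_ge sum_le].
have capped_le :=
  sum_capped_le (ltW rate_gt0) cap_ge1 (rate_budget params_ok) h u v.
have capped_ge :=
  sum_capped_ge (ltW rate_gt0) cap_ge1 (rate_budget params_ok) h u v.
have loss_le := heavy_loss_le u v.
have eps2_ge0 := sqr_ge0 eps.
apply/andP; split.
  apply: (@le_trans _ _ (rate D eps * ((1 - 2 * eps) * D%:R))).
    by rewrite mulrCA rateD; move: eps_pos; lra.
  by rewrite ler_pM2l ?rate_gt0 //; lra.
apply: (@le_trans _ _ (rate D eps * ((1 + eps) * D%:R))).
  by rewrite ler_pM2l ?rate_gt0 //; lra.
by rewrite mulrCA rateD; lra.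
Qed.

Lemma overflow_le v : (overflow h v)%:R <= 7 * eps * D%:R.
Proof.
rewrite -(ler_pM2l eps_pos).
have := overflow_exponent_le h_potential v; rewrite /overflow_exponent.
have : eps ^+ 2 * (degree (unzip1 h) v)%:R <= eps ^+ 2 * D%:R.
  by rewrite ler_wpM2l ?sqr_ge0 // ler_nat.
by have := overflow_budget params_ok; lra.
Qed.

Lemma best_outcome_potential_le e : e \notin unzip1 h ->
  potential (rate D eps) (cap eps) lam eps ((e, best_outcome lam eps h e) :: h)
  <= potential (rate D eps) (cap eps) lam eps h.
Proof.
move=> /sum_color_prob_range/andP[sum_ge sum_le].
apply: le_trans (mean_potential (ltW rate_gt0) cap_ge1 (rate_budget params_ok)
  (ltW lam_pos) (step_budget params_ok) sum_le (ltW eps_pos) eps_small sum_ge).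
apply: (arg_min_le_mean _ sum_le
  (fun o => potential _ _ _ _ ((e, o) :: h))) => c.
exact: color_prob_ge0 (ltW rate_gt0) cap_ge1 (rate_budget params_ok) _ _ _.
Qed.

End SmallPotentialConsequences.

(** * The game *)

Section Game.
Variables (R : realType) (n Delta : nat) (A : online_algorithm R n).
Variable adv : adversary A.
Hypothesis adv_legal : legal_adversary Delta adv.
Implicit Types (t : transcript n (coin A)) (e : edge n).

Lemma law_gt0_exists t e : exists r, 0 < law (o := A) t e r.
Proof.
have [/existsP//|/existsPn law_le0] := boolP [exists r, 0 < law (o := A) t e r].
have := law_sum1 (o := A) t e; rewrite big1 => [/eqP|r _].
  by rewrite eq_sym oner_eq0.
by apply/eqP; rewrite eq_le law_ge0 leNgt law_le0.
Qed.

Lemma play_size t : play adv t -> (size t <= #|{: edge n}|)%N.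
Proof.
move=> /(proj1 adv_legal) t_uniq.
by rewrite -(size_map (fun x => x.1.1)) -(card_uniqP t_uniq) max_card.
Qed.

Lemma play_backward_ind (P : transcript n (coin A) -> Prop) :
  (forall t, complete_play adv t -> P t) ->
  (forall t e, adv t = Some e ->
    (forall r, 0 < law t e r -> play adv (extend t e r) /\ P (extend t e r)) ->
    P t) ->
  forall t, play adv t -> P t.
Proof.
move=> P_complete P_extend t.
move: {-1}(_ - size t)%N (leqnn (#|{: edge n}| - size t)) => k.
elim: k t => [|k IH] t left_le t_play; case advE: (adv t) => [e|];
  try exact: P_complete.
- have [r r_gt0] := law_gt0_exists t e.
  have := play_size (play_extend t_play advE r_gt0).
  rewrite size_rcons => size_lt.
  by move: left_le; rewrite leqn0 subn_eq0 leqNgt size_lt.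
- apply: (P_extend _ _ advE) => r r_gt0.
  have ext_play := play_extend t_play advE r_gt0.
  split=> //; apply: IH ext_play.
  by rewrite size_rcons subnS; move: left_le; case: (_ - _)%N.
Qed.

Lemma play_degree t v : play adv t -> (degree (edges t) v <= Delta)%N.
Proof.
move: t; apply: play_backward_ind => [t t_complete|t e advE IH].
  by rewrite -(proj2 adv_legal t) // /max_degree; apply: (leq_bigmax v).
have [r /IH[_]] := law_gt0_exists t e; apply: leq_trans.
by rewrite /edges map_rcons /degree -cats1 count_cat leq_addr.
Qed.

Lemma prob_eq1 (P : pred (transcript n (coin A))) :
  (forall t, complete_play adv t -> P t) -> prob adv P = 1.
Proof.
move=> P_complete; suff prob_from1 t : play adv t -> forall k,
    (#|{: edge n}| <= k + size t)%N -> prob_from adv P k t = 1.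
  by apply: prob_from1; [apply: play_nil|rewrite addn0].
move: t; apply: play_backward_ind => [t t_complete|t e advE IH] k.
  by case: k => [|k] _ /=; rewrite ?(proj2 t_complete) P_complete.
case: k => [|k] size_ge.
  have [r /IH[/play_size]] := law_gt0_exists t e.
  by rewrite size_rcons ltnNge -[size t]add0n size_ge.
rewrite /= advE -[RHS](law_sum1 (o := A) t e); apply: eq_bigr => r _.
have := law_ge0 (o := A) t e r; rewrite le0r => /orP[/eqP ->|/IH[_ ->]].
- by rewrite mul0r.
- by rewrite mulr1.
- by rewrite size_rcons addnS -addSn.
Qed.

End Game.

Lemma sum_unit1 (R : realType) : \sum_(r : unit) 1 = 1 :> R.
Proof. by rewrite sumr_const card_unit. Qed.

Definition deterministic (R : realType) (n : nat)
    (f : transcript n unit -> edge n -> nat) : online_algorithm R n :=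
  @OnlineAlgorithm R n unit (fun _ _ _ => 1) (fun _ _ _ => ler01)
    (fun _ _ => sum_unit1 R) (fun t e _ => f t e).

(** * The algorithm *)

Definition fresh (m : nat) (s : seq nat) : nat :=
  head m [seq k <- iota m (size s).+1 | k \notin s].

Lemma freshP m s :
  [/\ m <= fresh m s, fresh m s <= m + size s & fresh m s \notin s]%N.
Proof.
set free := [seq k <- iota m (size s).+1 | k \notin s].
suff : fresh m s \in free.
  by rewrite /free mem_filter mem_iota addnS ltnS => /andP[-> /andP[-> ->]].
rewrite /fresh -/free; case freeE: free => [|k free']; last exact: mem_head.
suff : (size (iota m (size s).+1) <= size s)%N by rewrite size_iota ltnn.
apply: uniq_leq_size (iota_uniq _ _) _ => k k_iota; apply/negPn/negP => ks.
have : k \in free by rewrite /free mem_filter ks.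
by rewrite freeE.
Qed.

Section Algorithm.
Variables (R : realType) (n D : nat) (lam eps : R).
Implicit Types (t : transcript n unit) (e : edge n) (v : 'I_n).

Definition recorded t : history n 'I_D :=
  rev [seq (x.1.1, insub x.2) | x <- t].

Definition spare_clash t e : seq nat :=
  [seq x.2 | x <- t & share_endpoint x.1.1 e && (D <= x.2)%N].

Definition next_color t e : nat :=
  if best_outcome lam eps (recorded t) e is Some c then val c
  else fresh D (spare_clash t e).

Definition potential_algorithm : online_algorithm R n :=
  deterministic R next_color.

Lemma insub_next_color t e :
  insub (next_color t e) = best_outcome lam eps (recorded t) e.
Proof.
rewrite /next_color; case: best_outcome => [c|]; first by rewrite valK.
by rewrite insubN // -leqNgt; have [] := freshP D (spare_clash t e).
Qed.

Lemma recorded_extend t e (r : unit) :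
  recorded (@extend R n potential_algorithm t e r) =
  (e, best_outcome lam eps (recorded t) e) :: recorded t.
Proof. by rewrite /recorded map_rcons rev_rcons /= insub_next_color. Qed.

Lemma unzip1_recorded t : unzip1 (recorded t) = rev (edges t).
Proof. by rewrite /recorded /unzip1 map_rev -map_comp. Qed.

Lemma degree_recorded t v : degree (unzip1 (recorded t)) v = degree (edges t) v.
Proof. by rewrite unzip1_recorded /degree count_rev. Qed.

Lemma overflow_recorded t v : overflow (recorded t) v =
  count (fun x : round n unit => (v \in val x.1.1) && (D <= x.2)%N) t.
Proof.
rewrite /overflow /recorded count_rev count_map; apply: eq_count => x /=.
by case: insubP => [c c_lt _|/negbTE c_ge]; rewrite leqNgt ?c_lt ?c_ge.
Qed.

Lemma size_spare_clash t e m :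
  (forall v, overflow (recorded t) v <= m)%N ->
  (size (spare_clash t e) <= 2 * m)%N.
Proof.
move=> overflow_le; have /cards2P[u [v [_ eE]]] := valP e.
pose spare_at w (x : round n unit) := (w \in val x.1.1) && (D <= x.2)%N.
rewrite size_map size_filter.
apply: (@leq_trans (count (predU (spare_at u) (spare_at v)) t)).
  apply: sub_count => x /= /andP[/share_endpointP[w wx]].
  by rewrite eE !inE /spare_at => /orP[] /eqP <- ->; rewrite wx ?orbT.
apply: (@leq_trans (count (spare_at u) t + count (spare_at v) t)).
  by rewrite -count_predUI leq_addr.
by rewrite mul2n -addnn leq_add // -overflow_recorded.
Qed.

Lemma next_color_proper t e (x : round n unit) :
  x \in t -> share_endpoint x.1.1 e -> x.2 != next_color t e.
Proof.
move=> xt xe; apply/negP => /eqP xE; move: (insub_next_color t e) xE.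
rewrite /next_color; case outcomeE: best_outcome => [c|] _ xE.
  have : possible (color_prob (rate D eps) (cap eps) (recorded t) e)
      (best_outcome lam eps (recorded t) e).
    by rewrite /best_outcome; case: arg_minP.
  rewrite outcomeE /= => /eqP; apply; apply: color_prob_used xe.
  by rewrite mem_rev; apply/mapP; exists x; rewrite // xE valK.
have [fresh_ge _ /negP] := freshP D (spare_clash t e); apply.
by rewrite -xE; apply/mapP; exists x; rewrite // mem_filter xe xt xE fresh_ge.
Qed.

Variable adv : adversary potential_algorithm.

Lemma play_proper t : play adv t -> proper_coloring t.
Proof.
elim=> [|{}t e r _ IH _ _] x y //; rewrite !mem_rcons !inE.
move=> /orP[/eqP ->|xt] /orP[/eqP ->|yt] //=; first by rewrite eqxx.
- by move=> _; rewrite share_endpointC eq_sym; apply: next_color_proper.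
- by move=> _; apply: next_color_proper.
- exact: IH.
Qed.

Lemma play_colors_lt t m : play adv t ->
  (forall v, overflow (recorded t) v <= m)%N ->
  forall x, x \in t -> (x.2 < D + 2 * m + 1)%N.
Proof.
elim=> [|{}t e r _ IH _ _] //; rewrite recorded_extend => overflow_le x.
have past_overflow_le v : (overflow (recorded t) v <= m)%N.
  exact: leq_trans (leq_addl _ _) (overflow_le v).
rewrite mem_rcons inE => /orP[/eqP ->|xt]; last exact: IH.
rewrite /= /next_color addn1 ltnS; case: best_outcome => [c|].
  by rewrite (leq_trans (ltnW (ltn_ord c))) // leq_addr.
have [_ fresh_le _] := freshP D (spare_clash t e); apply: leq_trans fresh_le _.
by rewrite leq_add2l size_spare_clash.
Qed.

Lemma play_num_colors t m : play adv t ->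
  (forall v, overflow (recorded t) v <= m)%N ->
  (num_colors t <= D + 2 * m + 1)%N.
Proof.
move=> t_play overflow_le; rewrite -[leqRHS](size_iota 0).
apply: uniq_leq_size (undup_uniq _) _ => k; rewrite mem_undup => /mapP[x xt ->].
by rewrite mem_iota (play_colors_lt t_play overflow_le xt).
Qed.

Hypothesis adv_legal : legal_adversary D adv.

Lemma play_overflow_le_degree t v :
  play adv t -> (overflow (recorded t) v <= D)%N.
Proof.
move=> t_play; apply: leq_trans (play_degree adv_legal v t_play).
rewrite -degree_recorded /degree count_map.
by apply: sub_count => x /andP[].
Qed.

Hypothesis n_ge2 : (2 <= n)%N.
Hypothesis D_gt0 : (0 < D)%N.
Hypothesis params_ok : admissible n D lam eps.

Lemma play_potential_le t : play adv t ->
  potential (rate D eps) (cap eps) lam eps (recorded t) <=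
  expR (5%:R * ln n%:R).
Proof.
elim=> [|{}t e r t_play IH advE r_gt0]; first exact: potential_nil.
have := proj1 adv_legal _ (play_extend t_play advE r_gt0).
rewrite -rev_uniq -unzip1_recorded recorded_extend => /andP[e_new t_uniq].
apply: (le_trans _ IH); apply: best_outcome_potential_le => // v.
by rewrite degree_recorded; apply: (play_degree adv_legal v t_play).
Qed.

Lemma play_overflow_le t v :
  play adv t -> (overflow (recorded t) v)%:R <= 7 * eps * D%:R.
Proof.
move=> t_play; apply: (overflow_le params_ok) => [w|].
  by rewrite degree_recorded; apply: (play_degree adv_legal w t_play).
exact: play_potential_le.
Qed.

End Algorithm.

(** * Choice of the parameters *)

Section Tuning.
Variables (R : realType) (n D : nat).

Definition slack : R := 4 * (ln n%:R / D%:R) `^ (1 / 16).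

(* [star_budget] wants the compensator, of order [lam ^+ 2 / eps ^+ 4], to be
   dominated by [lam * eps ^+ 4], hence [lam] of order [eps ^+ 8]. *)
Definition tilt : R := slack ^+ 8 / 1024 ^+ 2.

Hypothesis n_ge2 : (2 <= n)%N.
Hypothesis D_gt0 : (0 < D)%N.

Let DR_gt0 : 0 < D%:R :> R. Proof. by rewrite ltr0n. Qed.
Let ln_ge : 1 / 2 <= ln n%:R :> R := ln_natr_ge_half R n_ge2.
Let ln_gt0 : 0 < ln n%:R :> R. Proof. by move: ln_ge; lra. Qed.

Lemma slack_gt0 : 0 < slack.
Proof. by rewrite mulr_gt0 // powR_gt0 // divr_gt0. Qed.

Lemma slack_expr16 : slack ^+ 16 * D%:R = 4 * 1024 ^+ 3 * ln n%:R.
Proof.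
rewrite /slack exprMn -(powR_mulrn 16 (powR_ge0 _ _)) -powRrM.
rewrite (_ : 1 / 16 * 16 = 1); last by field.
rewrite powRr1 ?divr_ge0 ?(ltW ln_gt0) //.
by rewrite -[LHS]mulrA divfK ?gt_eqF //; ring.
Qed.

Lemma slack_mul_degree :
  slack * D%:R = 4 * (D%:R `^ (15 / 16)) * (ln n%:R `^ (1 / 16)).
Proof.
rewrite /slack powRM ?invr_ge0 ?(ltW ln_gt0) // -!mulrA; congr (_ * _).
rewrite mulrC; congr (_ * _).
rewrite -powR_inv1 // -powRrM -[X in _ * X](powRr1 (ltW DR_gt0)) -powRD.
  by congr (_ `^ _); field.
by apply/implyP => _; rewrite gt_eqF.
Qed.

Lemma slack_mul_degree_ge1 : 1 <= slack * D%:R.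
Proof.
have slack_D_gt0 : 0 < slack * D%:R by rewrite mulr_gt0 // slack_gt0.
rewrite -(expr_ge1 (isT : 0 < 16)%N (ltW slack_D_gt0)).
rewrite exprMn (exprS D%:R 15) mulrA slack_expr16 mulr_ege1 //.
  by move: ln_ge; lra.
by rewrite exprn_ege1 // ler1n.
Qed.

Hypothesis slack_le : slack <= 1 / 4.

Let slack_expr_degree_le i j : (i <= j)%N ->
  slack ^+ j * D%:R <= slack ^+ i * D%:R.
Proof.
move=> ij; rewrite ler_wpM2r // ler_wiXn2l ?(ltW slack_gt0) //.
by move: slack_le; lra.
Qed.

Let slack_expr_degree_ge i : (i <= 16)%N ->
  4 * 1024 ^+ 3 * ln n%:R <= slack ^+ i * D%:R.
Proof. by rewrite -slack_expr16; apply: slack_expr_degree_le. Qed.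

Let slack_neq0 : slack != 0. Proof. by rewrite gt_eqF ?slack_gt0. Qed.

Let slack_expr_gt0 i : 0 < slack ^+ i * D%:R.
Proof. by rewrite mulr_gt0 ?exprn_gt0 ?slack_gt0. Qed.

Let compensatorE :
  compensator (cap slack) tilt = 4608 * slack ^+ 12 / 1024 ^+ 4.
Proof. by rewrite /compensator /increment_bound /cap /tilt; field. Qed.

Lemma slack_rate_budget : 2 * rate D slack * cap slack ^+ 2 <= 1.
Proof.
have -> : 2 * rate D slack * cap slack ^+ 2 =
    8 * (1 - slack) / (slack ^+ 2 * D%:R).
  by rewrite /rate /cap; field; rewrite slack_neq0 gt_eqF.
rewrite ler_pdivrMr //.
by have := slack_expr_degree_ge (isT : 2 <= 16)%N; move: slack_gt0 ln_ge; lra.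
Qed.

Lemma slack_step_budget : 24 * tilt * cap slack ^+ 2 <= 1.
Proof.
have -> : 24 * tilt * cap slack ^+ 2 = 96 * slack ^+ 6 / 1024 ^+ 2.
  by rewrite /tilt /cap; field.
have : slack ^+ 6 <= 1.
  by rewrite exprn_ile1 ?(ltW slack_gt0) //; move: slack_le; lra.
lra.
Qed.

Lemma slack_pair_budget :
  5 * ln n%:R + 2 * compensator (cap slack) tilt * D%:R < tilt * slack * D%:R.
Proof.
have -> : tilt * slack * D%:R = slack ^+ 9 * D%:R / 1024 ^+ 2.
  by rewrite /tilt; field.
rewrite compensatorE.
have := slack_expr_degree_le (isT : 9 <= 12)%N.
have := slack_expr_degree_ge (isT : 9 <= 16)%N; have := slack_expr_gt0 9.
move: (slack ^+ 9) (slack ^+ 12) => x y; lra.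
Qed.

Lemma slack_star_budget :
  8 * ln n%:R * D%:R + compensator (cap slack) tilt * D%:R ^+ 2 <
  tilt * (slack ^+ 3 / 32 * D%:R) * (D%:R * (slack / 2)).
Proof.
have -> : tilt * (slack ^+ 3 / 32 * D%:R) * (D%:R * (slack / 2)) =
    slack ^+ 12 * D%:R * D%:R / (64 * 1024 ^+ 2) by rewrite /tilt; field.
rewrite compensatorE.
have := ler_wpM2r (ltW DR_gt0) (slack_expr_degree_ge (isT : 12 <= 16)%N).
have := mulr_gt0 (slack_expr_gt0 12) DR_gt0.
by move: (slack ^+ 12) => x; lra.
Qed.

Lemma slack_admissible : admissible n D tilt slack.
Proof.
split=> //.
- exact: slack_gt0.
- by rewrite divr_gt0 // exprn_gt0 ?slack_gt0.
- exact: slack_rate_budget.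
- exact: slack_step_budget.
- exact: slack_pair_budget.
- exact: slack_star_budget.
- by have := slack_expr_degree_ge (isT : 2 <= 16)%N; move: ln_ge; lra.
Qed.

End Tuning.

Definition tuned_algorithm (R : realType) (n D : nat) : online_algorithm R n :=
  potential_algorithm n D (tilt R n D) (slack R n D).

Lemma tuned_num_colors (R : realType) n D
    (adv : adversary (tuned_algorithm R n D)) t :
  (2 <= n)%N -> (0 < D)%N -> legal_adversary D adv -> play adv t ->
  (num_colors t)%:R <= D%:R + 15 * (slack R n D * D%:R).
Proof.
move=> n_ge2 D_gt0 adv_legal t_play.
have slackD_ge1 := slack_mul_degree_ge1 R n_ge2 D_gt0.
have bound_ge0 : 0 <= 7 * slack R n D * D%:R by lra.
have overflow_bound v :
    (overflow (recorded D t) v <= Num.trunc (7 * slack R n D * D%:R))%N.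
  rewrite truncn_ge_nat //.
  have [slack_le|slack_gt] := leP (slack R n D) (1 / 4).
    apply: (play_overflow_le adv_legal n_ge2 D_gt0 _ v t_play).
    exact: slack_admissible.
  have : (overflow (recorded D t) v)%:R <= D%:R :> R.
    by rewrite ler_nat (play_overflow_le_degree adv_legal).
  by move/le_trans; apply; rewrite ler_peMl //; lra.
have := play_num_colors t_play overflow_bound.
rewrite -(ler_nat R) (natrD _ (_ + _)) natrD natrM => /le_trans; apply.
have : (Num.trunc (7 * slack R n D * D%:R))%:R <= 7 * slack R n D * D%:R.
  by rewrite truncn_le.
lra.
Qed.

Theorem theorem3p2 (R : realType) :
  exists C c : R, 0 < C /\ 0 < c /\
  exists A : forall n Delta : nat, online_algorithm R n,
  forall n Delta : nat, (2 <= n)%N -> (1 <= Delta)%N ->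
  forall adv : adversary (A n Delta), legal_adversary Delta adv ->
    (forall t, complete_play adv t -> proper_coloring t) /\
    1 - 1 / (n%:R `^ c) <=
      prob adv (fun t => (num_colors t)%:R <=
        Delta%:R + C * (Delta%:R `^ (15 / 16)) * ((ln n%:R) `^ (1 / 16))).
Proof.
exists 60, 1; split=> //; split=> //; exists (tuned_algorithm R).
move=> n D n_ge2 D_ge1 adv adv_legal; split=> [t [t_play _]|].
  exact: play_proper t_play.
rewrite (prob_eq1 adv_legal) => [|t [t_play _]].
  by rewrite gerBl divr_ge0 // powR_ge0.
have -> : 60 * D%:R `^ (15 / 16) * ln n%:R `^ (1 / 16) =
    15 * (slack R n D * D%:R).
  by rewrite slack_mul_degree //; ring.
exact: tuned_num_colors adv_legal t_play.
Qed.
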